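(* Consider a system in Fourier space of the form $\widehat V_t+\big(i|\xi|A_S(\xi)+|\xi|^2\overline B_S(\xi)\big)\widehat V=0$, $\xi\in\mathbb{R}^d\setminus\{0\}$, $t\ge0$, obtained as in the context from a symbol symmetrizable system without relaxation (zero order) term. Assume that there exists a compensating matrix symbol $\overline K_S(\xi)$ for the triplet $(I,A_S,\overline B_S)$, with $$[\overline K_S(\xi)A_S(\xi)]^s+\overline B_S(\xi)\ge g(\xi)I_n$$ for all $\xi\in\mathbb{R}^d\setminus\{0\}$ and some smooth positive function $g(\xi)$. In addition, suppose that $$|\xi|\,|\overline K_S(\xi)|\le C,\qquad \frac{|\xi|\,|\overline K_S(\xi)\overline B_S(\xi)^{1/2}|}{g(\xi)^{1/2}}\le C$$ for all $\xi\in\mathbb{R}^d\setminus\{0\}$ and some uniform constant $C>0$. Then there are uniform constants $C,k>0$ such that all solutions $\widehat V(\xi,t)$ satisfy $$|\widehat V(\xi,t)|\le C\exp\big(-k|\xi|^2g(\xi)t\big)|\widehat V(\xi,0)|\qquad\text{for all }\xi\in\mathbb{R}^d\setminus\{0\},\ t\ge0 .$$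
   Context: Setting: $U_t+\sum_{1\le|\alpha|\le m}L^\alpha D^\alpha U=0$ is a linear system with constant real $n\times n$ matrices $L^\alpha$ and no zero order term, $x\in\mathbb{R}^d$. For $\xi\ne0$, $\omega=\xi/|\xi|$, put $A(\xi)=\sum_{|\alpha|\text{ odd}}|\xi|^{|\alpha|-1}(-1)^{(|\alpha|-1)/2}\omega^\alpha L^\alpha$ and $B(\xi)=\sum_{|\alpha|\text{ even}}|\xi|^{|\alpha|}(-1)^{|\alpha|/2}\omega^\alpha L^\alpha$. The system is symbol symmetrizable: there is $S\in C^\infty(\mathbb{R}^d\setminus\{0\};\mathbb{R}^{n\times n})$ with $S(\xi)$ symmetric positive definite, $S(\xi)A(\xi)$, $S(\xi)B(\xi)$ symmetric and $S(\xi)B(\xi)\ge0$ for all $\xi\neq0$. Then $A_S=S^{1/2}AS^{-1/2}$ and $B_S=S^{1/2}BS^{-1/2}=:|\xi|^2\overline B_S(\xi)$ are smooth, real symmetric, with $\overline B_S\ge0$, and $\widehat V=S^{1/2}\widehat U$. A compensating matrix symbol for $(I,A_S,\overline B_S)$ is a $\overline K_S\in C^\infty(\mathbb{R}^d\setminus\{0\};\mathbb{R}^{n\times n})$ with $\overline K_S(\xi)$ skew-symmetric and $[\overline K_S(\xi)A_S(\xi)]^s+\overline B_S(\xi)$ positive definite for all $\xi\ne0$. $[M]^s=\frac12(M+M^\top)$; $|\cdot|$ denotes the norm of vectors or matrices. ''Uniform'' means independent of $\xi$, $t$ and the solution. *)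

(* Defs.v *)
From HB Require Import structures.
From mathcomp Require Import all_boot all_order all_algebra.
From mathcomp Require Import all_classical all_reals all_analysis.
From mathcomp Require Import complex.
Set Implicit Arguments.
Unset Strict Implicit.
Unset Printing Implicit Defensive.
Import Order.TTheory GRing.Theory Num.Theory.
Import numFieldNormedType.Exports.
Local Open Scope classical_set_scope.
Local Open Scope ring_scope.
Local Open Scope complex_scope.

Section Norms.
Context {R : realType}.

(* Only used for row and column vectors; matrices are measured with [opnorm].
   The library's norm on matrices is the maximum norm, hence these definitions. *)
Definition enorm (p q : nat) (x : 'M[R]_(p, q)) : R :=
  Num.sqrt (\sum_i \sum_j x i j ^+ 2).

Definition cnorm (p q : nat) (z : 'M[R[i]]_(p, q)) : R :=
  Num.sqrt (\sum_i \sum_j ComplexField.Normc.normc (z i j) ^+ 2).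

Definition opnorm (n : nat) (M : 'M[R]_n) : R :=
  sup [set enorm (M *m x) | x in [set x : 'cV[R]_n | enorm x <= 1]].

End Norms.

Section Matrices.
Context {R : realType} {n : nat}.
Implicit Types M : 'M[R]_n.

Definition posdefmx M : Prop :=
  M \is symmetricmx /\
  forall x : 'cV[R]_n, x != 0 -> 0 < (x^T *m M *m x) 0 0.

Definition possemidefmx M : Prop :=
  M \is symmetricmx /\
  forall x : 'cV[R]_n, 0 <= (x^T *m M *m x) 0 0.

Definition symmpart M : 'M[R]_n := 2^-1 *: (M + M^T).

(* The positive semidefinite square root; a positive semidefinite [M] has
   exactly one, and the value is 0 when there is none. *)
Definition sqrtmx M : 'M[R]_n :=
  xget 0 [set P : 'M[R]_n | possemidefmx P /\ P *m P = M].

End Matrices.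

Section Smooth.
Context {R : realType} {d : nat}.

(* [iter_partial [:: i1; ..; ik] f] is d/dx_i1 (... (d/dx_ik f)). *)
Definition iter_partial (s : seq 'I_d) (f : 'rV[R]_d -> R) : 'rV[R]_d -> R :=
  foldr (fun (i : 'I_d) (g : 'rV[R]_d -> R) =>
           fun x => 'D_(delta_mx 0 i : 'rV[R]_d) g x) f s.

(* C^oo on R^d \ {0}: all iterated partial derivatives exist there and are
   continuous. *)
Definition smooth_off0 (f : 'rV[R]_d -> R) : Prop :=
  forall (s : seq 'I_d) (x : 'rV[R]_d), x != 0 ->
    {for x, continuous (iter_partial s f)} /\
    forall i : 'I_d, derivable (iter_partial s f) x (delta_mx 0 i : 'rV[R]_d).

Definition smoothmx_off0 (n : nat) (F : 'rV[R]_d -> 'M[R]_n) : Prop :=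
  forall i j, smooth_off0 (fun x => F x i j).

End Smooth.

(* Exponents bounded by [m] are enough to enumerate all multi-indices of
   length at most [m]. *)
Definition mindex (d m : nat) := {ffun 'I_d -> 'I_m.+1}.

Definition mlength (d m : nat) (a : mindex d m) : nat := (\sum_i a i)%N.

Section Symbols.
Context {R : realType} {d n m : nat}.
Variable L : mindex d m -> 'M[R]_n.
Implicit Types xi : 'rV[R]_d.

Definition direction xi : 'rV[R]_d := (enorm xi)^-1 *: xi.

Definition monomial xi (a : mindex d m) : R := \prod_i xi 0 i ^+ a i.

Definition symbA xi : 'M[R]_n :=
  \sum_(a : mindex d m | (1 <= mlength a <= m)%N && odd (mlength a))
    (enorm xi ^+ (mlength a).-1 * (-1) ^+ ((mlength a).-1)./2
       * monomial (direction xi) a) *: L a.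

Definition symbB xi : 'M[R]_n :=
  \sum_(a : mindex d m | (1 <= mlength a <= m)%N && ~~ odd (mlength a))
    (enorm xi ^+ mlength a * (-1) ^+ (mlength a)./2
       * monomial (direction xi) a) *: L a.

Record symbol_symmetrizer (S : 'rV[R]_d -> 'M[R]_n) : Prop := {
  symmetrizer_smooth : smoothmx_off0 S;
  symmetrizer_posdef : forall xi, xi != 0 -> posdefmx (S xi);
  symmetrizer_symA : forall xi, xi != 0 -> S xi *m symbA xi \is symmetricmx;
  symmetrizer_symB : forall xi, xi != 0 -> S xi *m symbB xi \is symmetricmx;
  symmetrizer_psdB : forall xi, xi != 0 -> possemidefmx (S xi *m symbB xi) }.

Variable S : 'rV[R]_d -> 'M[R]_n.

Definition symbA_S xi : 'M[R]_n :=
  sqrtmx (S xi) *m symbA xi *m invmx (sqrtmx (S xi)).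

Definition symbB_S xi : 'M[R]_n :=
  sqrtmx (S xi) *m symbB xi *m invmx (sqrtmx (S xi)).

Definition symbBbar_S xi : 'M[R]_n := (enorm xi ^+ 2)^-1 *: symbB_S xi.

End Symbols.

Record compensating_symbol (R : realType) (d n : nat)
    (A Bbar K : 'rV[R]_d -> 'M[R]_n) : Prop := {
  compensating_smooth : smoothmx_off0 K;
  compensating_skew : forall xi, xi != 0 -> K xi \is skewmx;
  compensating_posdef : forall xi, xi != 0 ->
    posdefmx (symmpart (K xi *m A xi) + Bbar xi) }.

Section Solutions.
Context {R : realType} {d n : nat}.

(* R[i] is not a normed space over R in the library, so time derivatives of
   C^n-valued functions are taken on real and imaginary parts of entries. *)
Definition cv_re (v : R -> 'cV[R[i]]_n) (j : 'I_n) (t : R) : R :=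
  complex.Re (v t j 0).
Definition cv_im (v : R -> 'cV[R[i]]_n) (j : 'I_n) (t : R) : R :=
  complex.Im (v t j 0).

Definition cv_derivable (v : R -> 'cV[R[i]]_n) (t : R) : Prop :=
  forall j, derivable (cv_re v j) t 1 /\ derivable (cv_im v j) t 1.

Definition cv_derive (v : R -> 'cV[R[i]]_n) (t : R) : 'cV[R[i]]_n :=
  \col_j (derive1 (cv_re v j) t +i* derive1 (cv_im v j) t).

Definition cv_right_continuous (v : R -> 'cV[R[i]]_n) (t : R) : Prop :=
  forall j, cv_re v j s @[s --> t^'+] --> cv_re v j t /\
            cv_im v j s @[s --> t^'+] --> cv_im v j t.

(* Classical solutions on [0, +oo[ of
     V_t + (i |xi| A(xi) + |xi|^2 Bbar(xi)) V = 0   for every xi != 0: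
   continuous down to t = 0 and differentiable for t > 0 (the one-sided
   derivative at 0 then exists and satisfies the equation as well).  Values at
   t < 0 are irrelevant. *)
Definition fourier_solution (A Bbar : 'rV[R]_d -> 'M[R]_n)
    (V : 'rV[R]_d -> R -> 'cV[R[i]]_n) : Prop :=
  forall xi, xi != 0 ->
    cv_right_continuous (V xi) 0 /\
    forall t, 0 < t ->
      cv_derivable (V xi) t /\
      cv_derive (V xi) t
        + ((0 +i* 1) *: map_mx (real_complex R) (enorm xi *: A xi)
           + map_mx (real_complex R) (enorm xi ^+ 2 *: Bbar xi)) *m V xi t = 0.

End Solutions.

(* Main.v *)
(* At a fixed frequency xi write r = |xi| and V = a + ib.  The energy
   E = |a|^2 + |b|^2 only dissipates through B: E' = -2 r^2 <V, B V>.
   Because K is skew, the derivative of the compensator a . K b contains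
   -r (a . K A a + b . K A b), which is at most r (-g E + <V, B V>); the
   remaining term involves K B and is absorbed, through r |K B^(1/2)| <= C g^(1/2)
   and Young's inequality, by half of r g E plus a multiple of r <V, B V>.
   Hence W = E + delta r (a . K b), for a small delta depending on C only,
   is equivalent to E (as r |K| <= C) and satisfies
   W' <= -(delta / 3) r^2 g W. *)
Require Import Defs.
From HB Require Import structures.
From mathcomp Require Import all_boot all_order all_algebra.
From mathcomp Require Import all_classical all_reals all_analysis.
From mathcomp Require Import complex ring lra.
Import Order.TTheory GRing.Theory Num.Theory.
Import numFieldNormedType.Exports.
Local Open Scope classical_set_scope.
Local Open Scope ring_scope.

(** * Symmetric and skew matrices, the dot product and the Euclidean norm *)

Lemma symmetricmxP (R : realType) (n : nat) (M : 'M[R]_n) :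
  M \is symmetricmx <-> M^T = M.
Proof.
rewrite is_hermitianmxE expr0 scale1r map_mx_id //.
by split=> [/eqP <-|->].
Qed.

Lemma skewmxP (R : realType) (n : nat) (M : 'M[R]_n) :
  M \is skewmx <-> M^T = - M.
Proof.
rewrite is_hermitianmxE expr1 scaleN1r map_mx_id //.
by split=> [/eqP {2}->|->]; rewrite opprK.
Qed.

Lemma enorm_ge0 (R : realType) (p q : nat) (x : 'M[R]_(p, q)) : 0 <= enorm x.
Proof. exact: sqrtr_ge0. Qed.

Lemma enorm_eq0 (R : realType) (p q : nat) (x : 'M[R]_(p, q)) :
  (enorm x == 0) = (x == 0).
Proof.
have h i : 0 <= \sum_j x i j ^+ 2 by apply: sumr_ge0 => j _; exact: sqr_ge0.
have s0 : 0 <= \sum_i \sum_j x i j ^+ 2 by apply: sumr_ge0 => i _; exact: h.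
rewrite /enorm sqrtr_eq0 (_ : (_ <= 0) = (\sum_i \sum_j x i j ^+ 2 == 0)).
  2: by rewrite eq_le s0 andbT.
apply/eqP/eqP => [x0|->]; last first.
  by rewrite big1// => i _; rewrite big1// => j _; rewrite mxE expr0n.
apply/matrixP => i j; rewrite mxE; apply/eqP; rewrite -sqrf_eq0.
have xi0 := psumr_eq0P (fun i _ => h i) x0.
by rewrite (psumr_eq0P _ (xi0 i isT))// => k _; exact: sqr_ge0.
Qed.

Section Dot.
Context {R : realType} {n : nat}.
Implicit Types (x y z : 'cV[R]_n) (M : 'M[R]_n).

Definition dot x y : R := (x^T *m y) 0 0.

Lemma dotE x y : dot x y = \sum_i x i 0 * y i 0.
Proof. by rewrite /dot mxE; apply: eq_bigr => i _; rewrite mxE. Qed.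

Lemma dotC x y : dot x y = dot y x.
Proof. by rewrite !dotE; apply: eq_bigr => i _; rewrite mulrC. Qed.

Lemma dotDl x y z : dot (x + y) z = dot x z + dot y z.
Proof. by rewrite /dot linearD mulmxDl mxE. Qed.

Lemma dotDr x y z : dot x (y + z) = dot x y + dot x z.
Proof. by rewrite /dot mulmxDr mxE. Qed.

Lemma dotNl x y : dot (- x) y = - dot x y.
Proof. by rewrite /dot linearN mulNmx mxE. Qed.

Lemma dotNr x y : dot x (- y) = - dot x y.
Proof. by rewrite /dot mulmxN mxE. Qed.

Lemma dotZl a x y : dot (a *: x) y = a * dot x y.
Proof. by rewrite /dot linearZ -scalemxAl mxE. Qed.

Lemma dotZr a x y : dot x (a *: y) = a * dot x y.
Proof. by rewrite /dot -scalemxAr mxE. Qed.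

Lemma dot_mulmxr M x y : dot x (M *m y) = dot (M^T *m x) y.
Proof. by rewrite /dot trmx_mul trmxK mulmxA. Qed.

Lemma dot_ge0 x : 0 <= dot x x.
Proof. by rewrite dotE; apply: sumr_ge0 => i _; rewrite -expr2 sqr_ge0. Qed.

Lemma enormE x : enorm x = Num.sqrt (dot x x).
Proof.
rewrite /enorm dotE; congr Num.sqrt; apply: eq_bigr => i _.
by rewrite big_ord_recl big_ord0 addr0 expr2.
Qed.

Lemma sqr_enorm x : enorm x ^+ 2 = dot x x.
Proof. by rewrite enormE sqr_sqrtr ?dot_ge0. Qed.

Lemma dot_eq0 x : (dot x x == 0) = (x == 0).
Proof. by rewrite -sqr_enorm sqrf_eq0 enorm_eq0. Qed.

Lemma enormZ a x : enorm (a *: x) = `|a| * enorm x.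
Proof.
by rewrite !enormE dotZl dotZr mulrA -expr2 sqrtrM ?sqr_ge0// sqrtr_sqr.
Qed.

(** Cauchy-Schwarz inequality, obtained by testing nonnegativity of the dot product on a multiple of
    the component of [y] orthogonal to [x]. *)
Lemma dot_le_enorm x y : `|dot x y| <= enorm x * enorm y.
Proof.
have [->|x0] := eqVneq x 0.
  by rewrite {1}/dot trmx0 mul0mx mxE normr0 mulr_ge0 ?enorm_ge0.
have p : 0 < dot x x by rewrite lt_neqAle eq_sym dot_eq0 x0 dot_ge0.
rewrite -(@ler_pXn2r _ 2) ?nnegrE ?mulr_ge0 ?enorm_ge0 ?normr_ge0//.
rewrite real_normK ?num_real// exprMn !sqr_enorm.
(* The square of this vector expands to [a * (a * c - b ^+ 2)], and the factor [a] is positive. *)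
have := dot_ge0 (dot x x *: y - dot x y *: x).
rewrite !dotDl !dotDr !dotNl !dotNr !dotZl !dotZr (dotC y x).
set a := dot x x; set b := dot x y; set c := dot y y => h.
have : 0 <= a * (a * c - b ^+ 2) by apply: (le_trans h); lra.
by rewrite pmulr_rge0// subr_ge0.
Qed.

End Dot.

(** * Existence of positive semidefinite square roots *)

Lemma polynomial_interpolation {F : fieldType} (s : seq F) (h : F -> F) :
  exists p : {poly F}, forall x, x \in s -> p.[x] = h x.
Proof.
elim: s => [|x s [p ps]]; first by exists 0.
have [xs|xs] := boolP (x \in s).
  by exists p => y; rewrite inE => /predU1P[->|]; exact: ps.
pose q := \prod_(z <- s) ('X - z%:P).
have qx : q.[x] != 0 by rewrite -rootE root_prod_XsubC.
(* Newton step: [q] vanishes on the old nodes and not at [x], so adding a multiple of it corrects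
   the value at [x] alone. *)
exists (p + ((h x - p.[x]) / q.[x]) *: q) => y.
rewrite !hornerE inE => /predU1P[->|ys].
  by rewrite mulfVK// addrC subrK.
have /rootP -> : root q y by rewrite root_prod_XsubC.
by rewrite mulr0 addr0 ps.
Qed.

Lemma Re_real_complexM (R : rcfType) (c : R) (z : R[i]) :
  complex.Re (real_complex R c * z) = c * complex.Re z.
Proof. by case: z => a b /=; rewrite mul0r subr0. Qed.

Lemma Im_real_complexM (R : rcfType) (c : R) (z : R[i]) :
  complex.Im (real_complex R c * z) = c * complex.Im z.
Proof. by case: z => a b /=; rewrite mul0r addr0. Qed.

Section SquareRoot.
Context {R : realType}.

Lemma possemidefmxE (n : nat) (M : 'M[R]_n) :
  possemidefmx M <-> M^T = M /\ forall x : 'cV[R]_n, 0 <= dot x (M *m x).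
Proof.
rewrite /possemidefmx symmetricmxP /dot.
by split=> -[sM pM]; split=> // x; have := pM x; rewrite mulmxA.
Qed.

Lemma possemidefmx_sqr (n : nat) (Q : 'M[R]_n) :
  Q^T = Q -> possemidefmx (Q *m Q).
Proof.
move=> sQ; apply/possemidefmxE; rewrite trmx_mul sQ; split=> // x.
by rewrite -mulmxA dot_mulmxr sQ dot_ge0.
Qed.

(** The complexification of [M] is Hermitian, so the complex spectral theorem applies and the
    eigenvalues are real. They are nonnegative because the real and imaginary parts of a complex
    eigenvector are real vectors on which [M] acts by the same eigenvalue, and one of them is
    nonzero. *)
Lemma possemidefmx_spectral (n : nat) (M : 'M[R]_n) : possemidefmx M ->
  exists (P : 'M[R[i]]_n) (r : 'rV[R]_n), [/\ P \in unitmx,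
    forall i, 0 <= r 0 i &
    map_mx (real_complex R) M
      = invmx P *m diag_mx (map_mx (real_complex R) r) *m P].
Proof.
move=> /possemidefmxE[sM pM]; set Mc := map_mx (real_complex R) M.
have hMc : Mc \is hermsymmx.
  apply: realsym_hermsym.
    rewrite is_hermitianmxE expr0 scale1r map_mx_id//.
    by rewrite /Mc map_trmx sM.
  by apply/mxOverP => i j; rewrite mxE; apply/complex_realP; exists (M i j).
have /orthomx_spectralP := hermitian_normalmx hMc.
set P := spectralmx Mc => eqM.
have uP : P \in unitmx := spectral_unit Mc.
have [r rE] : exists r : 'rV[R]_n, spectral_diag Mc = map_mx (real_complex R) r.
  exists (map_mx (@complex.Re R) (spectral_diag Mc)); apply/matrixP => i j.
  rewrite !mxE RRe_real//.
  by have /mxOverP := hermitian_spectral_diag_real hMc; exact.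
exists P, r; split=> [|i|]; [exact: uP | | by rewrite -rE; exact: eqM].
(* The rows of [P] are left eigenvectors of [Mc]; symmetry of [M] turns their real and imaginary
   parts into right eigenvectors below. *)
have eigP : row i P *m Mc = (r 0 i)%:C%C *: row i P.
  rewrite -row_mul eqM mulmxA mulKVmx// mul_diag_mx rE.
  by apply/rowP => j; rewrite !mxE.
have rowi_neq0 : row i P != 0.
  apply/negP => /eqP; rewrite rowE => /(congr1 (mulmx^~ (invmx P))).
  rewrite mulmxK// mul0mx => /rowP/(_ i); rewrite !mxE !eqxx => /eqP.
  by rewrite oner_eq0.
pose a := \col_j complex.Re (P i j); pose b := \col_j complex.Im (P i j).
have eqa : M *m a = r 0 i *: a.
  apply/colP => j; move/rowP/(_ j)/(congr1 (@complex.Re R)): eigP.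
  rewrite !mxE raddf_sum /= Re_real_complexM => <-.
  by apply: eq_bigr => k _; rewrite !mxE [X in _ = complex.Re X]mulrC
    Re_real_complexM -[in LHS]sM mxE.
have eqb : M *m b = r 0 i *: b.
  apply/colP => j; move/rowP/(_ j)/(congr1 (@complex.Im R)): eigP.
  rewrite !mxE raddf_sum /= Im_real_complexM => <-.
  by apply: eq_bigr => k _; rewrite !mxE [X in _ = complex.Im X]mulrC
    Im_real_complexM -[in LHS]sM mxE.
have h (c : 'cV_n) : M *m c = r 0 i *: c -> c != 0 -> 0 <= r 0 i.
  move=> eqc c0; have := pM c; rewrite eqc dotZr pmulr_lge0//.
  by rewrite lt_neqAle eq_sym dot_eq0 c0 dot_ge0.
(* Either part, if nonzero, gives the sign of [r 0 i]; if both vanish, so does row [i] of the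
   invertible matrix [P]. *)
have [a0|] := eqVneq a 0; last exact: h.
have [b0|] := eqVneq b 0; last exact: h.
case/eqP: rowi_neq0; apply/rowP => j; rewrite !mxE.
move/colP/(_ j): a0; move/colP/(_ j): b0; rewrite !mxE.
by case: (P i j) => u v /= -> ->.
Qed.

(** Transposition reverses products, which is harmless since a matrix commutes with the polynomials
    in it. *)
Lemma trmx_horner_mx (n : nat) (M : 'M[R]_n.+1) (p : {poly R}) :
  (horner_mx M p)^T = horner_mx M^T p.
Proof.
elim/poly_ind: p => [|p c IH]; first by rewrite !rmorph0 trmx0.
rewrite !rmorphD !rmorphM /= !horner_mx_X !horner_mx_C linearD /= tr_scalar_mx.
by rewrite trmx_mul IH; congr (_ + _); exact: comm_mx_horner.
Qed.

(* Q is the polynomial in M taking the fourth roots of the eigenvalues: being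
   real symmetric, its square is positive semidefinite. *)
Lemma possemidefmx_sqrt_ex (n : nat) (M : 'M[R]_n) : possemidefmx M ->
  exists P : 'M[R]_n, possemidefmx P /\ P *m P = M.
Proof.
(* [horner_mx] needs positive size; in size 0 all matrices coincide. *)
case: n M => [|n] M pM.
  exists M; split=> //; by rewrite [LHS]flatmx0 [RHS]flatmx0.
have [U [r [uU r0 MU]]] := possemidefmx_spectral _ _ pM.
have [p pE] := polynomial_interpolation [seq r 0 i | i <- enum 'I_n.+1]
  (fun x => Num.sqrt (Num.sqrt x)).
pose Q := horner_mx M p.
have sQ : Q^T = Q.
  by rewrite /Q trmx_horner_mx; case/possemidefmxE: pM => ->.
exists (Q *m Q); split; first exact: possemidefmx_sqr.
apply: (map_mx_inj (f := real_complex R)).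
have -> : Q *m Q *m (Q *m Q) = horner_mx M (p ^+ 4).
  by rewrite rmorphXn /= -/Q !exprS expr0 mulr1 -!mulmxE !mulmxA.
rewrite map_horner_mx MU horner_mx_uconjC// horner_mx_diag.
congr (_ *m diag_mx _ *m _); apply/rowP => i.
rewrite !mxE horner_map /= hornerE pE ?map_f ?mem_enum//.
by rewrite -[4%N]/(2 * 2)%N exprM !sqr_sqrtr ?sqrtr_ge0.
Qed.
End SquareRoot.

(** Existence of a root rules out the default value 0 in the definition of [sqrtmx]. *)
Lemma sqrtmxP (R : realType) (n : nat) (M : 'M[R]_n) : possemidefmx M ->
  possemidefmx (sqrtmx M) /\ sqrtmx M *m sqrtmx M = M.
Proof. by move=> /possemidefmx_sqrt_ex; exact: xgetPex. Qed.

Lemma posdefmx_possemidefmx (R : realType) (n : nat) (M : 'M[R]_n) :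
  posdefmx M -> possemidefmx M.
Proof.
move=> [sM pM]; split=> // x; have [->|/pM/ltW//] := eqVneq x 0.
by rewrite mulmx0 mxE.
Qed.

Lemma sqrtmx_unit (R : realType) (n : nat) (M : 'M[R]_n) :
  posdefmx M -> sqrtmx M \in unitmx.
Proof.
move=> pM; have [/possemidefmxE[sT _] TT] :=
  sqrtmxP _ _ _ (posdefmx_possemidefmx _ _ _ pM).
(* A nonzero [v] in the left kernel of the root would make the quadratic form of [M] vanish at
   [v]. *)
rewrite unitmxE unitfE; apply/negP => /det0P[v v0 vT].
have := pM.2 v^T; rewrite trmx_eq0 => /(_ v0).
by rewrite trmxK -{1}TT mulmxA vT !mul0mx mxE ltxx.
Qed.

(** Conjugation by the root of [M] applied to [N] is a congruence applied to [M *m N]. This carries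
    symmetry and semidefiniteness of the products with [S] over to the conjugated symbols. *)
Lemma conj_sqrtmxE (R : realType) (n : nat) (M N : 'M[R]_n) : posdefmx M ->
  sqrtmx M *m N *m invmx (sqrtmx M)
    = (invmx (sqrtmx M))^T *m (M *m N) *m invmx (sqrtmx M).
Proof.
move=> pM; have uT := sqrtmx_unit _ _ _ pM.
have [/possemidefmxE[sT _] TT] :=
  sqrtmxP _ _ _ (posdefmx_possemidefmx _ _ _ pM).
by rewrite trmx_inv sT -{4}TT -!mulmxA mulKmx.
Qed.

(** * Symmetry and semidefiniteness of the symmetrized symbols *)

Section Symmetrized.
Context {R : realType} {d n m : nat}.
Variables (L : mindex d m -> 'M[R]_n) (S : 'rV[R]_d -> 'M[R]_n).
Hypothesis hS : symbol_symmetrizer L S.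

Lemma symbA_S_sym (xi : 'rV[R]_d) :
  xi != 0 -> (symbA_S L S xi)^T = symbA_S L S xi.
Proof.
move=> x0; rewrite /symbA_S conj_sqrtmxE; last exact: (symmetrizer_posdef hS).
have /symmetricmxP sA := symmetrizer_symA hS x0.
by rewrite [LHS]trmx_mul (trmx_mul _ (S xi *m _)) trmxK sA mulmxA.
Qed.

Lemma symbBbar_S_psd (xi : 'rV[R]_d) :
  xi != 0 -> possemidefmx (symbBbar_S L S xi).
Proof.
move=> x0; rewrite /symbBbar_S /symbB_S conj_sqrtmxE; last first.
  exact: (symmetrizer_posdef hS).
have /possemidefmxE[sB pB] := symmetrizer_psdB hS x0.
apply/possemidefmxE; split=> [|x].
  by rewrite linearZ/= [X in _ *: X]trmx_mul (trmx_mul _ (S xi *m _)) trmxK sB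
    mulmxA.
rewrite -scalemxAl dotZr mulr_ge0 ?invr_ge0 ?exprn_ge0 ?sqrtr_ge0//.
(* The form at [x] is the form of [S xi *m symbB L xi] at the image of [x] under the inverse
   root. *)
rewrite -(mulmxA _ _ x) -(mulmxA _^T) dot_mulmxr trmxK; exact: pB.
Qed.

End Symmetrized.

(** * The operator norm bounds the action of a matrix *)

Section OperatorNorm.
Context {R : realType} {n : nat}.
Implicit Types (M : 'M[R]_n) (x y : 'cV[R]_n).

(** The constant is the Frobenius norm, by Cauchy-Schwarz on each row. It shows that the supremum
    defining [opnorm] is taken over a bounded set. *)
Lemma mulmx_enorm_bounded M :
  exists2 c : R, 0 <= c & forall x, enorm (M *m x) <= c * enorm x.
Proof.
pose c := \sum_i dot (row i M)^T (row i M)^T.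
have c0 : 0 <= c by apply: sumr_ge0 => i _; exact: dot_ge0.
exists (Num.sqrt c) => [|x]; first exact: sqrtr_ge0.
rewrite [enorm x]enormE -sqrtrM// enormE ler_sqrt ?mulr_ge0 ?dot_ge0//.
rewrite dotE mulr_suml; apply: ler_sum => i _.
have -> : (M *m x) i 0 = dot (row i M)^T x.
  by rewrite dotE mxE; apply: eq_bigr => j _; rewrite !mxE.
rewrite -expr2 -real_normK ?num_real// -!sqr_enorm -exprMn.
by rewrite ler_pXn2r ?nnegrE ?mulr_ge0 ?enorm_ge0// dot_le_enorm.
Qed.

Lemma le_opnorm M x : enorm (M *m x) <= opnorm M * enorm x.
Proof.
have [->|x0] := eqVneq x 0.
  by rewrite mulmx0 (eqP (_ : enorm 0 == 0)) ?enorm_eq0 ?mulr0.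
have ex : 0 < enorm x by rewrite lt_neqAle eq_sym enorm_eq0 x0 enorm_ge0.
have [c c0 Mc] := mulmx_enorm_bounded M.
rewrite -ler_pdivrMr// mulrC.
have -> : (enorm x)^-1 * enorm (M *m x) = enorm (M *m ((enorm x)^-1 *: x)).
  by rewrite -scalemxAr enormZ ger0_norm// invr_ge0 ltW.
apply: ub_le_sup.
  exists c => _ [y /= y1 <-]; apply: le_trans (Mc y) _.
  by rewrite -[leRHS]mulr1 ler_wpM2l.
exists ((enorm x)^-1 *: x) => //=.
by rewrite enormZ ger0_norm ?invr_ge0 ?enorm_ge0// mulVf ?gt_eqF.
Qed.

End OperatorNorm.

(** * Energy and compensator inequalities at a fixed frequency *)

Section Dissipation.
Context {R : realType} {n : nat}.

Lemma dot_symmpart (M : 'M[R]_n) (x : 'cV[R]_n) :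
  dot x (symmpart M *m x) = dot x (M *m x).
Proof.
rewrite /symmpart -scalemxAl dotZr mulmxDl dotDr (dot_mulmxr M^T) trmxK.
by rewrite (dotC (M *m x)); field.
Qed.

Variables (A B K : 'M[R]_n) (g r C : R).
Hypotheses (sA : A^T = A) (pB : possemidefmx B) (sK : K^T = - K) (g0 : 0 < g)
  (r0 : 0 < r)
  (hKg : forall x : 'cV[R]_n,
     g * dot x x <= dot x (K *m (A *m x)) + dot x (B *m x))
  (hK1 : r * opnorm K <= C)
  (hK2 : r * opnorm (K *m sqrtmx B) <= C * Num.sqrt g).

(** Splitting [B] as the square of its root [P] puts one factor with [K], where [hK2] applies, and
    leaves the other on [y], where it yields the dissipated quantity. *)
Lemma cross_term_bound (x y : 'cV[R]_n) :
  r * `|dot x (K *m (B *m y))|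
    <= 2^-1 * (C ^+ 2 * dot y (B *m y) + g * dot x x).
Proof.
have [/possemidefmxE[sP _] PP] := sqrtmxP _ _ _ pB.
have hKP := hK2; set P := sqrtmx B in sP PP hKP *.
have -> : dot y (B *m y) = enorm (P *m y) ^+ 2.
  by rewrite sqr_enorm -PP -mulmxA dot_mulmxr sP.
rewrite -(sqr_enorm x); set p := enorm (P *m y); set q := enorm x.
have p0 : 0 <= p := enorm_ge0 _ _ _ _; have q0 : 0 <= q := enorm_ge0 _ _ _ _.
have h : `|dot x (K *m (B *m y))| <= q * (opnorm (K *m P) * p).
  apply: le_trans (dot_le_enorm _ _) _.
  by rewrite ler_wpM2l// -PP !mulmxA -mulmxA le_opnorm.
set s := Num.sqrt g in hKP; have -> : g = s ^+ 2 by rewrite sqr_sqrtr// ltW.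
have /le_trans : r * `|dot x (K *m (B *m y))|
    <= r * (q * (opnorm (K *m P) * p)).
  by rewrite ler_wpM2l// ltW.
apply.
have -> : r * (q * (opnorm (K *m P) * p)) = (r * opnorm (K *m P)) * (p * q).
  by ring.
apply: le_trans (ler_wpM2r (mulr_ge0 p0 q0) hKP) _.
(* Young's inequality for the product of [C * p] and [s * q]. *)
have := sqr_ge0 (C * p - s * q); lra.
Qed.

(** Here [a'] and [b'] are the time derivatives of the real and imaginary parts, so the left side is
    the derivative of the modified energy W. The second condition on [delta] lets the dissipation of
    E pay for all [B]-terms of the compensator. *)
Lemma dissipation (delta : R) (a b a' b' : 'cV[R]_n) : 0 <= delta ->
  delta * (1 + C ^+ 2 / 2) <= 2 ->
  a' = r *: (A *m b) - r ^+ 2 *: (B *m a) ->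
  b' = - (r *: (A *m a)) - r ^+ 2 *: (B *m b) ->
  dot a' a + dot a a' + (dot b' b + dot b b')
    + delta * r * (dot a' (K *m b) + dot a (K *m b'))
  <= - (delta / 2 * r ^+ 2 * g) * (dot a a + dot b b).
Proof.
move=> d0 hd -> ->.
have /possemidefmxE[sB B0] := pB.
have ab := cross_term_bound a b; have ba := cross_term_bound b a.
have ga := hKg a; have gb := hKg b; have Ba := B0 a; have Bb := B0 b.
rewrite !mulmxDr !mulmxN -!scalemxAr.
rewrite !dotDl !dotDr !dotNl !dotNr !dotZl !dotZr.
(* Terms are brought to a common form: by symmetry of [A] the [A]-terms in the derivative of E
   cancel, and skewness moves [K] across the dot product. *)
have -> : dot (A *m b) a = dot a (A *m b) by exact: dotC.
have -> : dot (A *m a) b = dot a (A *m b) by rewrite dotC dot_mulmxr sA dotC.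
have -> : dot b (A *m a) = dot a (A *m b) by rewrite dot_mulmxr sA dotC.
have -> : dot (B *m a) a = dot a (B *m a) by exact: dotC.
have -> : dot (B *m b) b = dot b (B *m b) by exact: dotC.
have -> : dot (A *m b) (K *m b) = - dot b (K *m (A *m b)).
  by rewrite dot_mulmxr sK mulNmx dotNl dotC.
have -> : dot (B *m a) (K *m b) = - dot b (K *m (B *m a)).
  by rewrite dot_mulmxr sK mulNmx dotNl dotC.
move: ab ba ga gb Ba Bb.
set Ka := dot a (K *m (A *m a)); set Kb := dot b (K *m (A *m b)).
set Da := dot a (B *m a); set Db := dot b (B *m b).
set u := dot a (K *m (B *m b)); set v := dot b (K *m (B *m a)).
set Ea := dot a a; set Eb := dot b b.
move=> ab ba ga gb Ba Bb.
have {}ab : - (r * u) <= 2^-1 * (C ^+ 2 * Db + g * Ea).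
  by apply: le_trans ab; rewrite -mulrN ler_pM2l// -normrN ler_norm.
have {}ba : r * v <= 2^-1 * (C ^+ 2 * Da + g * Eb).
  by apply: le_trans ba; rewrite ler_pM2l// ler_norm.
(* [hKg] contributes the 1 and the gain [- g] times the energy; the cross terms contribute
   [C ^+ 2 / 2] and give back half of that gain. *)
have h1 : - Ka - Kb - r * u + r * v
    <= (1 + C ^+ 2 / 2) * (Da + Db) - g / 2 * (Ea + Eb) by lra.
have h2 := ler_wpM2l d0 h1.
have h3 := ler_wpM2r (addr_ge0 Ba Bb) hd.
(* This is the claim with the common factor [r ^+ 2] removed; the 2 comes from the derivative of
   E. *)
have h4 : delta * (- Ka - Kb - r * u + r * v) - 2 * (Da + Db)
    <= - (delta / 2 * g) * (Ea + Eb) by lra.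
have := ler_wpM2l (sqr_ge0 r) h4; lra.
Qed.

(** This makes the modified energy comparable to E: it stays between E/2 and 3E/2. *)
Lemma compensator_bound (delta : R) (a b : 'cV[R]_n) : 0 <= delta ->
  delta * C <= 1 ->
  `|delta * r * dot a (K *m b)| <= (dot a a + dot b b) / 2.
Proof.
move=> d0 hd; have rd : 0 <= delta * r by rewrite mulr_ge0// ltW.
rewrite normrM (ger0_norm rd) -!sqr_enorm.
have h : `|dot a (K *m b)| <= enorm a * (opnorm K * enorm b).
  apply: le_trans (dot_le_enorm _ _) _.
  by rewrite ler_wpM2l ?enorm_ge0 ?le_opnorm.
set p := enorm a in h *; set q := enorm b in h *.
have p0 : 0 <= p := enorm_ge0 _ _ _ _; have q0 : 0 <= q := enorm_ge0 _ _ _ _.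
apply: le_trans (ler_wpM2l rd h) _.
have -> : delta * r * (p * (opnorm K * q))
    = delta * (r * opnorm K) * (p * q) by ring.
have h1 : delta * (r * opnorm K) <= 1.
  by apply: le_trans hd; rewrite ler_wpM2l.
apply: le_trans (ler_wpM2r (mulr_ge0 p0 q0) h1) _.
have := sqr_ge0 (p - q); lra.
Qed.

End Dissipation.

(** * Derivatives and limits of time-dependent vectors; a Gronwall inequality *)

Section VectorCalculus.
Context {R : realType} {n : nat}.
Implicit Types (a b : R -> 'cV[R]_n) (M : 'M[R]_n).

Lemma is_derive_dot a b (a' b' : 'cV[R]_n) (t : R) :
  (forall i, is_derive t (1 : R) (fun s => a s i 0) (a' i 0)) ->
  (forall i, is_derive t (1 : R) (fun s => b s i 0) (b' i 0)) ->
  is_derive t (1 : R) (fun s => dot (a s) (b s)) (dot a' (b t) + dot (a t) b').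
Proof.
move=> ha hb.
have -> : (fun s => dot (a s) (b s))
    = \sum_(i < n) ((fun s => a s i 0) * (fun s => b s i 0)).
  by apply/funext => s; rewrite fct_sumE dotE.
have h := is_derive_sum (fun i => is_deriveM (ha i) (hb i)).
apply: (is_derive_eq h); rewrite !dotE -big_split; apply: eq_bigr => i _ /=.
by rewrite addrC; congr (_ + _); exact: mulrC.
Qed.

Lemma is_derive_mulmx M a (a' : 'cV[R]_n) (t : R) :
  (forall i, is_derive t (1 : R) (fun s => a s i 0) (a' i 0)) ->
  forall i, is_derive t (1 : R) (fun s => (M *m a s) i 0) ((M *m a') i 0).
Proof.
move=> ha i.
have -> : (fun s => (M *m a s) i 0)
    = \sum_(j < n) (M i j \*: (fun s => a s j 0)).
  by apply/funext => s; rewrite fct_sumE mxE.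
have h := is_derive_sum (fun j => is_deriveZ (M i j) (ha j)).
by apply: (is_derive_eq h); rewrite mxE.
Qed.

Lemma cvg_dot {T : Type} (F : set_system T) {FF : Filter F}
    (a b : T -> 'cV[R]_n) (x y : 'cV[R]_n) :
  (forall i, a s i 0 @[s --> F] --> x i 0) ->
  (forall i, b s i 0 @[s --> F] --> y i 0) ->
  dot (a s) (b s) @[s --> F] --> dot x y.
Proof.
move=> ha hb; rewrite (_ : (fun s => _) = fun s => \sum_i a s i 0 * b s i 0).
  by rewrite dotE; apply: cvg_big => [|i _];
    [exact: add_continuous|exact: cvgM].
by apply/funext => s; rewrite dotE.
Qed.

Lemma cvg_mulmx {T : Type} (F : set_system T) {FF : Filter F} M
    (a : T -> 'cV[R]_n) (x : 'cV[R]_n) :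
  (forall i, a s i 0 @[s --> F] --> x i 0) ->
  forall i, (M *m a s) i 0 @[s --> F] --> (M *m x) i 0.
Proof.
move=> ha i; rewrite (_ : (fun s => _) = fun s => \sum_j M i j * a s j 0).
  by rewrite mxE; apply: cvg_big => [|j _];
    [exact: add_continuous|apply: cvgM => //; exact: cvg_cst].
by apply/funext => s; rewrite mxE.
Qed.

End VectorCalculus.

(** With the integrating factor, [expR (c * s) * W s] has nonpositive derivative, hence is
    nonincreasing. *)
Lemma gronwall_decay {R : realType} (W : R -> R) (c : R) :
  W s @[s --> 0^'+] --> W 0 ->
  (forall t : R, 0 < t ->
     exists2 w : R, is_derive t (1 : R) W w & w <= - c * W t) ->
  forall t : R, 0 <= t -> W t <= expR (- c * t) * W 0.
Proof.
move=> W0 dW t t0.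
pose f : R -> R := (fun s => expR (c * s)) * W.
have df (s : R) : 0 < s -> exists2 w : R, is_derive s (1 : R) f w & w <= 0.
  move=> /dW[w hw wle]; exists (expR (c * s) * w + W s * (c * expR (c * s))).
    have he : is_derive s (1 : R) (fun s => expR (c * s)) (c * expR (c * s)).
      have h := is_deriveZ c (is_derive_id s (1 : R)).
      apply: (is_derive_eq (is_derive1_comp (is_derive_expR (c * s)) h)).
      by rewrite [_ *: _]mulr1 mulrC.
    exact: is_deriveM he hw.
  rewrite (_ : _ + _ = expR (c * s) * (w + c * W s)); last by ring.
  by rewrite pmulr_rle0 ?expR_gt0//; lra.
have : f t <= f 0.
  (* The derivative is controlled at positive times only; right continuity of [W] extends
     monotonicity to 0. *)
  apply: (@ler0_derive1_nincry R f 0) => //.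
  - by move=> s; rewrite in_itv/= andbT => /df[w hw _]; exact: ex_derive.
  - move=> s; rewrite in_itv/= andbT => /df[w hw wle].
    by rewrite derive1E derive_val.
  apply/continuous_within_itvcyP; split.
    move=> s; rewrite in_itv/= andbT => /df[w hw _].
    apply: differentiable_continuous; apply/derivable1_diffP; exact: ex_derive.
  apply: cvgM => //.
  apply: cvg_at_right_filter.
  apply: (cvg_comp (fun s => c * s) expR); last exact: continuous_expR.
  by apply: cvgM; [exact: cvg_cst|exact: cvg_id].
rewrite /f /= !fctE mulr0 expR0 mul1r => h.
by rewrite mulNr expRN mulrC ler_pdivlMr ?expR_gt0// mulrC.
Qed.

(** * Complex solutions as pairs of real vectors *)

Section ComplexVectors.
Context {R : realType} {n : nat}.

Definition re_cv (z : 'cV[R[i]]_n) : 'cV[R]_n := map_mx (@complex.Re R) z.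
Definition im_cv (z : 'cV[R[i]]_n) : 'cV[R]_n := map_mx (@complex.Im R) z.

Lemma cnormE (z : 'cV[R[i]]_n) :
  cnorm z = Num.sqrt (dot (re_cv z) (re_cv z) + dot (im_cv z) (im_cv z)).
Proof.
rewrite /cnorm !dotE -big_split; congr Num.sqrt; apply: eq_bigr => i _.
rewrite big_ord_recl big_ord0 addr0 !mxE /=.
case: (z i 0) => u v /=.
by rewrite sqr_sqrtr ?addr_ge0 ?sqr_ge0// !expr2.
Qed.

Lemma re_mulmx_real (M : 'M[R]_n) (z : 'cV[R[i]]_n) :
  re_cv (map_mx (real_complex R) M *m z) = M *m re_cv z.
Proof.
apply/colP => j; rewrite !mxE raddf_sum /=; apply: eq_bigr => k _.
by rewrite !mxE Re_real_complexM.
Qed.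

Lemma im_mulmx_real (M : 'M[R]_n) (z : 'cV[R[i]]_n) :
  im_cv (map_mx (real_complex R) M *m z) = M *m im_cv z.
Proof.
apply/colP => j; rewrite !mxE raddf_sum /=; apply: eq_bigr => k _.
by rewrite !mxE Im_real_complexM.
Qed.

Lemma re_scale_i (z : 'cV[R[i]]_n) : re_cv (Complex 0 1 *: z) = - im_cv z.
Proof.
apply/colP => j; rewrite !mxE; case: (z j 0) => u v /=.
by rewrite mul0r mul1r sub0r.
Qed.

Lemma im_scale_i (z : 'cV[R[i]]_n) : im_cv (Complex 0 1 *: z) = re_cv z.
Proof.
apply/colP => j; rewrite !mxE; case: (z j 0) => u v /=.
by rewrite mul0r mul1r add0r.
Qed.

Lemma re_cvD (y z : 'cV[R[i]]_n) : re_cv (y + z) = re_cv y + re_cv z.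
Proof. exact: map_mxD. Qed.

Lemma im_cvD (y z : 'cV[R[i]]_n) : im_cv (y + z) = im_cv y + im_cv z.
Proof. exact: map_mxD. Qed.

End ComplexVectors.

(** Since [A] and [B] are real, only the factor i in front of [A] couples the real and imaginary
    parts. *)
Lemma fourier_solution_reim (R : realType) (d n : nat)
    (A B : 'rV[R]_d -> 'M[R]_n) (V : 'rV[R]_d -> R -> 'cV[R[i]]_n)
    (xi : 'rV[R]_d) (t : R) :
  fourier_solution A B V -> xi != 0 -> 0 < t ->
  let r := enorm xi in let a s := re_cv (V xi s) in let b s := im_cv (V xi s) in
  let a' := r *: (A xi *m b t) - r ^+ 2 *: (B xi *m a t) in
  let b' := - (r *: (A xi *m a t)) - r ^+ 2 *: (B xi *m b t) in
  (forall i, is_derive t (1 : R) (fun s => a s i 0) (a' i 0)) /\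
  (forall i, is_derive t (1 : R) (fun s => b s i 0) (b' i 0)).
Proof.
move=> sol xi0 t0 r a b a' b'; have [_ /(_ _ t0)[dV eqV]] := sol _ xi0.
have aE i : (fun s => a s i 0) = cv_re (V xi) i.
  by apply/funext => s; rewrite /a /re_cv mxE.
have bE i : (fun s => b s i 0) = cv_im (V xi) i.
  by apply/funext => s; rewrite /b /im_cv mxE.
have eqV1 : cv_derive (V xi) t
    + (Complex 0 1 *: (map_mx (real_complex R) (r *: A xi) *m V xi t)
       + map_mx (real_complex R) (r ^+ 2 *: B xi) *m V xi t) = 0.
  by rewrite -[RHS]eqV mulmxDl -scalemxAl.
split=> i.
- rewrite aE; apply: DeriveDef; first by have [] := dV i.
  have := congr1 re_cv eqV1.
  rewrite !re_cvD re_scale_i im_mulmx_real re_mulmx_real -/(a t) -/(b t).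
  move=> /colP/(_ i); rewrite -derive1E -!scalemxAl /a' !mxE /=; lra.
- rewrite bE; apply: DeriveDef; first by have [] := dV i.
  have := congr1 im_cv eqV1.
  rewrite !im_cvD im_scale_i re_mulmx_real im_mulmx_real -/(a t) -/(b t).
  move=> /colP/(_ i); rewrite -derive1E -!scalemxAl /b' !mxE /=; lra.
Qed.

(** * Decay of solutions, first at one frequency and then uniformly *)

Lemma fourier_solution_decay (R : realType) (d n : nat)
    (A B K : 'rV[R]_d -> 'M[R]_n) (V : 'rV[R]_d -> R -> 'cV[R[i]]_n)
    (xi : 'rV[R]_d) (g C delta : R) :
  fourier_solution A B V -> xi != 0 -> 0 < enorm xi ->
  (A xi)^T = A xi -> possemidefmx (B xi) -> (K xi)^T = - K xi -> 0 < g ->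
  (forall x : 'cV[R]_n,
     g * dot x x <= dot x (K xi *m (A xi *m x)) + dot x (B xi *m x)) ->
  enorm xi * opnorm (K xi) <= C ->
  enorm xi * opnorm (K xi *m sqrtmx (B xi)) <= C * Num.sqrt g ->
  0 < delta -> delta * (1 + C ^+ 2 / 2) <= 2 -> delta * C <= 1 ->
  forall t, 0 <= t ->
    cnorm (V xi t)
      <= 2 * expR (- (delta / 6) * enorm xi ^+ 2 * g * t) * cnorm (V xi 0).
Proof.
move=> sol xi0; set r := enorm xi => r0 sA pB sK g0 hKg hK1 hK2 d0 hd1 hd2 t t0.
pose a s := re_cv (V xi s); pose b s := im_cv (V xi s).
pose E s := dot (a s) (a s) + dot (b s) (b s).
pose W s := E s + delta * r * dot (a s) (K xi *m b s).
have E0 s : 0 <= E s by rewrite addr_ge0 ?dot_ge0.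
have WE s : `|W s - E s| <= E s / 2.
  rewrite /W addrC addKr.
  exact: (compensator_bound _ _ _ r0 hK1 _ _ _ (ltW d0) hd2).
have W_le s : W s <= 3 / 2 * E s by have := WE s; rewrite ler_norml; lra.
have W_ge s : E s / 2 <= W s by have := WE s; rewrite ler_norml; lra.
(* [dissipation] bounds the derivative of [W] by [- (delta / 2 * r ^+ 2 * g)] times [E]; replacing
   [E] by two thirds of [W] turns 1/2 into 1/3. *)
pose c := delta / 3 * r ^+ 2 * g.
have c0 : 0 < c by rewrite !mulr_gt0 ?exprn_gt0 ?invr_gt0.
have decay : W t <= expR (- c * t) * W 0.
  apply: gronwall_decay => // [|s s0].
    have [cV _] := sol _ xi0.
    have ca i : a s i 0 @[s --> 0^'+] --> a 0 i 0.
      have [h _] := cV i; rewrite /a /re_cv !mxE.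
      by under eq_cvg do rewrite mxE.
    have cb i : b s i 0 @[s --> 0^'+] --> b 0 i 0.
      have [_ h] := cV i; rewrite /b /im_cv !mxE.
      by under eq_cvg do rewrite mxE.
    apply: cvgD; first by apply: cvgD; apply: cvg_dot.
    by apply: cvgM; [exact: cvg_cst|apply: cvg_dot => //; exact: cvg_mulmx].
  have [da db] := fourier_solution_reim _ _ _ _ _ _ _ _ sol xi0 s0.
  have dE := is_deriveD (is_derive_dot _ _ _ _ _ da da)
    (is_derive_dot _ _ _ _ _ db db).
  have dF := is_deriveZ (delta * r)
    (is_derive_dot _ _ _ _ _ da (is_derive_mulmx (K xi) _ _ _ db)).
  have dW := is_deriveD dE dF.
  eexists; first exact: dW.
  apply: le_trans (dissipation _ _ _ _ _ _ sA pB sK g0 r0 hKg hK2 _ (a s) (b s)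
    _ _ (ltW d0) hd1 erefl erefl) _.
  by have := ler_wpM2l (ltW c0) (W_le s); rewrite /c -/(E s); lra.
rewrite !cnormE -/(a t) -/(b t) -/(a 0) -/(b 0) -/(E t) -/(E 0).
(* The rate is halved, from 1/3 to 1/6, because [cnorm] is the square root of the energy. *)
set e := expR (- (delta / 6) * r ^+ 2 * g * t).
have eE : expR (- c * t) = e ^+ 2.
  by rewrite -expRM_natl; congr expR; rewrite /c; field.
have e0 : 0 < e := expR_gt0 _.
have -> : 2 * e * Num.sqrt (E 0) = Num.sqrt ((2 * e) ^+ 2 * E 0).
  by rewrite sqrtrM ?sqr_ge0// sqrtr_sqr gtr0_norm// mulr_gt0.
rewrite ler_sqrt; last exact: mulr_ge0 (sqr_ge0 _) (E0 _).
rewrite exprMn; rewrite eE in decay.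
(* [E t] is at most twice [W t], hence at most [3 * e ^+ 2 * E 0]; the constant 2 covers the square
   root of 3. *)
have := ler_wpM2l (sqr_ge0 e) (W_le 0); have := W_ge t.
have := mulr_ge0 (sqr_ge0 e) (E0 0); lra.
Qed.

Theorem lemma4p2 (R : realType) (d n m : nat)
  (L : mindex d m -> 'M[R]_n) (S : 'rV[R]_d -> 'M[R]_n)
  (hS : symbol_symmetrizer L S)
  (K : 'rV[R]_d -> 'M[R]_n)
  (hK : compensating_symbol (symbA_S L S) (symbBbar_S L S) K)
  (g : 'rV[R]_d -> R)
  (hg_smooth : smooth_off0 g)
  (hg_pos : forall xi : 'rV[R]_d, xi != 0 -> 0 < g xi)
  (hKg : forall xi : 'rV[R]_d, xi != 0 ->
     possemidefmx (symmpart (K xi *m symbA_S L S xi) + symbBbar_S L S xi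
                   - (g xi)%:M))
  (C : R) (hC : 0 < C)
  (hK1 : forall xi : 'rV[R]_d, xi != 0 -> enorm xi * opnorm (K xi) <= C)
  (hK2 : forall xi : 'rV[R]_d, xi != 0 ->
     enorm xi * opnorm (K xi *m sqrtmx (symbBbar_S L S xi))
       / Num.sqrt (g xi) <= C) :
  exists C' k : R, 0 < C' /\ 0 < k /\
    forall V : 'rV[R]_d -> R -> 'cV[R[i]]_n,
      fourier_solution (symbA_S L S) (symbBbar_S L S) V ->
      forall (xi : 'rV[R]_d) (t : R), xi != 0 -> 0 <= t ->
        cnorm (V xi t)
          <= C' * expR (- k * enorm xi ^+ 2 * g xi * t) * cnorm (V xi 0).
Proof.
have D0 : 0 < 1 + C + C ^+ 2 by rewrite !addr_gt0// exprn_gt0.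
(* One choice, depending on [C] only, meets both smallness conditions:
   [delta * (1 + C ^+ 2 / 2) <= 2] and [delta * C <= 1]. *)
pose delta := (1 + C + C ^+ 2)^-1.
have d0 : 0 < delta by rewrite invr_gt0.
exists 2, (delta / 6); split; first by []; split; first by rewrite divr_gt0.
move=> V sol xi t xi0 t0.
apply: (fourier_solution_decay _ _ _ _ _ K _ _ _ C _ sol xi0).
- by rewrite lt_neqAle eq_sym enorm_eq0 xi0 sqrtr_ge0.
- exact: symbA_S_sym.
- exact: symbBbar_S_psd.
- by apply/skewmxP; exact: (compensating_skew hK).
- exact: hg_pos.
- move=> x; have /possemidefmxE[_ /(_ x)] := hKg _ xi0.
  rewrite !mulmxDl mulNmx mul_scalar_mx !dotDr dotNr dotZr dot_symmpart mulmxA.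
  by rewrite subr_ge0.
- exact: hK1.
- by have := hK2 _ xi0; rewrite ler_pdivrMr// sqrtr_gt0 hg_pos.
- exact: d0.
- rewrite mulrC ler_pdivrMr//; have := sqr_ge0 C; lra.
- rewrite mulrC ler_pdivrMr//; have := sqr_ge0 C; lra.
- exact: t0.
Qed.
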